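(* Let $a,b,c,d$ be generic real parameters, $k\ge 0$ an integer and $p$ a complex number. The function $$\widetilde\Psi_{p,k}(x,y)=\widehat P^{(a,b)}_k\!\Bigl(\tfrac{x}{x+y}\Bigr)\,\psi_p^{(c,\;d-b-c,\;2a+b+d+3)}(x+y)$$ satisfies $$C_{12}\widetilde\Psi_{p,k}=\frac{4p^2-1}{4}\,\widetilde\Psi_{p,k},\qquad C_{34}\widetilde\Psi_{p,k}=\frac{(2k+a+b+1)^2-1}{4}\,\widetilde\Psi_{p,k}.$$
   Context: Functions are considered on the open triangle $\{(x,y): x>0,\ y>0,\ x+y<1\}$. ''Generic'' means that the hypergeometric series below are well defined, i.e. neither $a+1$ nor $c+1$ is a non-positive integer. Special functions: ${}_2F_1$ is the Gauss hypergeometric function; $$\widehat P^{(\alpha,\beta)}_n(x)={}_2F_1(-n,\,n+\alpha+\beta+1;\,\alpha+1;\,x),$$ $$\psi_m^{(\beta,\gamma,\delta)}(x)=x^{m-\frac12(\delta+1)}\,{}_2F_1\bigl(m+\tfrac12(\beta+\gamma+1),\,m+\tfrac12(\beta-\gamma+1);\,\beta+1;\,1-x\bigr),\quad 0<x<1.$$ Operators: with $[A,B]=AB-BA$, $\{A,B\}=AB+BA$, $X_3$ = multiplication by $1-x-y$, $$L_3=xy(\partial_x^2+\partial_y^2-2\partial_x\partial_y)+\bigl((a+1)y-(b+1)x\bigr)(\partial_x-\partial_y),$$ $$L=x(1-x)\partial_x^2+y(1-y)\partial_y^2-2xy\,\partial_x\partial_y+(a+1-(a+b+c+3)x)\partial_x+(b+1-(a+b+c+3)y)\partial_y,$$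 $$C_{34}=-L_3+\tfrac{(a+b+1)^2-1}{4},\qquad C_{234}=-L+\tfrac{(a+b+c+2)^2-1}{4},$$ $$C_{12}=-\tfrac{a+d+2}{2}[X_3,C_{234}]+\tfrac12\{X_3-1,C_{234}\}+\tfrac{(a+d+2)^2-(d-b-c)^2}{4}(X_3-1)+C_{34}+\tfrac{(a+d+2)^2-1}{4}.$$ *)

(* Defs.v *)
From Stdlib Require Import Reals Factorial.
From Coquelicot Require Import Coquelicot.

Open Scope R_scope.

(** * Special functions *)

Fixpoint Cpochhammer (q : C) (n : nat) : C :=
  match n with
  | O => RtoC 1
  | S m => (Cpochhammer q m * (q + RtoC (INR m)))%C
  end.

Definition CSeries (u : nat -> C) : C :=
  (Series (fun n => Re (u n)), Series (fun n => Im (u n))).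

(* Meaningful for |z| < 1 and g not in {0, -1, -2, ...}: only the power series
   is used here, not its analytic continuation. *)
Definition hyp2F1 (q r g z : C) : C :=
  CSeries (fun n =>
    (Cpochhammer q n * Cpochhammer r n
       / (Cpochhammer g n * RtoC (INR (fact n))) * z ^ n)%C).

Definition Cexp (z : C) : C :=
  (exp (Re z) * cos (Im z), exp (Re z) * sin (Im z)).

(* The principal power x^w of a positive real x. *)
Definition Rpow_C (x : R) (w : C) : C := Cexp (w * RtoC (ln x))%C.

Definition Phat (alpha beta : R) (n : nat) (x : R) : C :=
  hyp2F1 (RtoC (- INR n)) (RtoC (INR n + alpha + beta + 1))
         (RtoC (alpha + 1)) (RtoC x).

Definition psi (beta gamma delta : R) (m : C) (x : R) : C :=
  (Rpow_C x (m - RtoC ((delta + 1) / 2))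
   * hyp2F1 (m + RtoC ((beta + gamma + 1) / 2))
            (m + RtoC ((beta - gamma + 1) / 2))
            (RtoC (beta + 1)) (RtoC (1 - x)))%C.

Definition Psi_tilde (a b c d : R) (p : C) (k : nat) (x y : R) : C :=
  (Phat a b k (x / (x + y))
   * psi c (d - b - c) (2 * a + b + d + 3) p (x + y))%C.

(** * Operators on complex-valued functions of two real variables

    Functions are total on R x R; the operators are local, so their values on
    an open set depend only on the restriction of the function to that set. *)

Definition fun2 := R -> R -> C.
Definition oper := fun2 -> fun2.

Definition in_triangle (x y : R) : Prop := 0 < x /\ 0 < y /\ x + y < 1.

Definition Derive_RC (f : R -> C) (x : R) : C :=
  (Derive (fun t => Re (f t)) x, Derive (fun t => Im (f t)) x).

Definition dx : oper := fun f x y => Derive_RC (fun t => f t y) x.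
Definition dy : oper := fun f x y => Derive_RC (fun t => f x t) y.

Definition mulop (g : R -> R -> R) : oper := fun f x y => (RtoC (g x y) * f x y)%C.
Definition scalop (r : R) : oper := mulop (fun _ _ => r).
Definition addop (A B : oper) : oper := fun f x y => (A f x y + B f x y)%C.
Definition oppop (A : oper) : oper := fun f x y => (- A f x y)%C.
Definition subop (A B : oper) : oper := addop A (oppop B).
Definition compop (A B : oper) : oper := fun f => A (B f).

Declare Scope oper_scope.
Delimit Scope oper_scope with oper.
Bind Scope oper_scope with oper.
Notation "A + B" := (addop A B) : oper_scope.
Notation "A - B" := (subop A B) : oper_scope.
Notation "- A" := (oppop A) : oper_scope.
Notation "A * B" := (compop A B) : oper_scope.

Definition commutator (A B : oper) : oper := (A * B - B * A)%oper.
Definition anticommutator (A B : oper) : oper := (A * B + B * A)%oper.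

Definition X3 : oper := mulop (fun x y => 1 - x - y).

Definition L3 (a b : R) : oper :=
  (mulop (fun x y => (x * y)%R) * (dx * dx + dy * dy - scalop 2 * (dx * dy))
   + mulop (fun x y => ((a + 1) * y - (b + 1) * x)%R) * (dx - dy))%oper.

Definition L (a b c : R) : oper :=
  (mulop (fun x _ => (x * (1 - x))%R) * (dx * dx)
   + mulop (fun _ y => (y * (1 - y))%R) * (dy * dy)
   - mulop (fun x y => (2 * x * y)%R) * (dx * dy)
   + mulop (fun x _ => (a + 1 - (a + b + c + 3) * x)%R) * dx
   + mulop (fun _ y => (b + 1 - (a + b + c + 3) * y)%R) * dy)%oper.

Definition C34 (a b : R) : oper :=
  (- L3 a b + scalop (((a + b + 1) ^ 2 - 1) / 4)%R)%oper.

Definition C234 (a b c : R) : oper :=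
  (- L a b c + scalop (((a + b + c + 2) ^ 2 - 1) / 4)%R)%oper.

Definition C12 (a b c d : R) : oper :=
  (scalop (- ((a + d + 2) / 2))%R * commutator X3 (C234 a b c)
   + scalop (1 / 2)%R * anticommutator (X3 - scalop 1) (C234 a b c)
   + scalop (((a + d + 2) ^ 2 - (d - b - c) ^ 2) / 4)%R * (X3 - scalop 1)
   + C34 a b
   + scalop (((a + d + 2) ^ 2 - 1) / 4)%R)%oper.

(* [Derive] is total with junk values; this predicate says that the partial
   derivatives of order at most 2 on the triangle are genuine. *)
Definition partially_derivable (f : fun2) : Prop :=
  forall x y, in_triangle x y ->
    @ex_derive R_AbsRing C_R_NormedModule (fun t => f t y) x /\
    @ex_derive R_AbsRing C_R_NormedModule (fun t => f x t) y.

Definition twice_partially_derivable (f : fun2) : Prop :=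
  partially_derivable f /\ partially_derivable (dx f) /\ partially_derivable (dy f).

(* Main.v *)
(** With [s = x + y] and [t = x / (x + y)], the operator [L3] differentiates in
    [t] only and becomes the hypergeometric operator annihilating the polynomial
    factor up to its eigenvalue, while
    [L = s (1 - s) d_s^2 + (a + b + 2 - (a + b + c + 3) s) d_s + L3 / s].
    In [C12] the anticommutator with [X3 - 1 = - s] turns [- L] into [s L] plus
    first-order terms in [s], so its [L3] is cancelled by that of [C34], and [C12]
    is an ordinary differential operator in [s].  Conjugating it by the power of
    [s] in [psi] gives the Gauss equation in [1 - s]. *)

Require Import Defs.
From Stdlib Require Import Reals Factorial Lra Lia.
From Coquelicot Require Import Coquelicot.

(** * Derivatives of complex-valued functions of a real variable *)

(** Taken componentwise, as in [Derive_RC], so that every rule reduces to its real counterpart;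
    [is_derive_RC_ex_derive] makes the link with differentiability in the normed module. *)
Definition is_derive_RC (f : R -> C) (x : R) (l : C) : Prop :=
  is_derive (fun t => Re (f t)) x (Re l) /\
  is_derive (fun t => Im (f t)) x (Im l).

Lemma is_derive_RC_eq (f : R -> C) (x : R) (l l' : C) :
  is_derive_RC f x l -> l = l' -> is_derive_RC f x l'.
Proof. now intros H <-. Qed.

Lemma is_derive_RC_unique (f : R -> C) (x : R) (l : C) :
  is_derive_RC f x l -> Derive_RC f x = l.
Proof.
  intros [H1 H2]. unfold Derive_RC. destruct l.
  f_equal; now apply is_derive_unique.
Qed.

Lemma is_derive_RC_ext_loc (f g : R -> C) (x : R) (l : C) :
  locally x (fun t => f t = g t) -> is_derive_RC f x l -> is_derive_RC g x l.
Proof.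
  intros H [H1 H2]; split;
    (eapply is_derive_ext_loc; [ | eassumption ]);
    revert H; apply filter_imp; now intros t ->.
Qed.

Lemma is_derive_RC_const (k : C) (x : R) : is_derive_RC (fun _ => k) x 0.
Proof. split; apply @is_derive_const. Qed.

Lemma is_derive_RC_RtoC (f : R -> R) (x l : R) :
  is_derive f x l -> is_derive_RC (fun t => RtoC (f t)) x (RtoC l).
Proof. intros H; split; [exact H | exact (is_derive_const 0 x)]. Qed.

Lemma is_derive_RC_plus (f g : R -> C) (x : R) (l m : C) :
  is_derive_RC f x l -> is_derive_RC g x m ->
  is_derive_RC (fun t => f t + g t)%C x (l + m).
Proof. intros [H1 H2] [H3 H4]; split; now apply @is_derive_plus. Qed.

Lemma is_derive_RC_mult (f g : R -> C) (x : R) (l m : C) :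
  is_derive_RC f x l -> is_derive_RC g x m ->
  is_derive_RC (fun t => f t * g t)%C x (l * g x + f x * m).
Proof.
  intros [H1 H2] [H3 H4]; split; simpl.
  - replace (fst l * fst (g x) - snd l * snd (g x)
        + (fst (f x) * fst m - snd (f x) * snd m))
      with (minus (plus (mult (fst l) (fst (g x))) (mult (fst (f x)) (fst m)))
              (plus (mult (snd l) (snd (g x))) (mult (snd (f x)) (snd m))))
      by (unfold minus, plus, mult, opp; simpl; ring).
    apply @is_derive_minus; apply @is_derive_mult; auto; intros; apply Rmult_comm.
  - replace (fst l * snd (g x) + snd l * fst (g x)
        + (fst (f x) * snd m + snd (f x) * fst m))
      with (plus (plus (mult (fst l) (snd (g x))) (mult (fst (f x)) (snd m)))
              (plus (mult (snd l) (fst (g x))) (mult (snd (f x)) (fst m))))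
      by (unfold plus, mult; simpl; ring).
    apply @is_derive_plus; apply @is_derive_mult; auto; intros; apply Rmult_comm.
Qed.

Lemma is_derive_RC_comp (f : R -> C) (g : R -> R) (x : R) (l : C) (m : R) :
  is_derive_RC f (g x) l -> is_derive g x m ->
  is_derive_RC (fun t => f (g t)) x (RtoC m * l).
Proof.
  intros [H1 H2] H; split; simpl.
  - replace (m * fst l - 0 * snd l) with (scal m (fst l))
      by (unfold scal; simpl; unfold mult; simpl; ring).
    now apply (is_derive_comp (fun t => Re (f t))).
  - replace (m * snd l + 0 * fst l) with (scal m (snd l))
      by (unfold scal; simpl; unfold mult; simpl; ring).
    now apply (is_derive_comp (fun t => Im (f t))).
Qed.

(** Write [f] as [Re f] times the fixed vector 1 plus [Im f] times the fixed vector i; each summand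
    is a differentiable real function times a constant vector. *)
Lemma is_derive_RC_ex_derive (f : R -> C) (x : R) (l : C) :
  is_derive_RC f x l -> @ex_derive R_AbsRing C_R_NormedModule f x.
Proof.
  intros [H1 H2].
  apply (ex_derive_ext (V := C_R_NormedModule)
    (fun t => plus (scal (Re (f t)) (RtoC 1 : C_R_NormedModule))
                (scal (Im (f t)) (Ci : C_R_NormedModule)))).
  { intros t. unfold plus, scal; simpl. unfold prod_plus, prod_scal; simpl.
    unfold plus, scal; simpl. unfold mult; simpl.
    destruct (f t) as [u v]; simpl. f_equal; ring. }
  apply @ex_derive_plus; eexists; apply @is_derive_scal_l; eassumption.
Qed.

(** For w = u + iv the components are exp(u ln t) times the cosine and sine of v ln t, so the real
    chain rule applies to each. *)
Lemma is_derive_Rpow_C (w : C) (x : R) : 0 < x ->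
  is_derive_RC (fun t => Rpow_C t w) x (w / RtoC x * Rpow_C x w).
Proof.
  intros Hx. destruct w as [u v].
  unfold Cdiv; rewrite <- RtoC_inv by lra.
  unfold Rpow_C, Cexp; split; simpl; auto_derive; auto;
    fold (u * ln x - v * 0)%R; field; lra.
Qed.

(** * Power series with complex coefficients *)

(** Coefficients are complex but the argument is real: the series are only evaluated at x/(x+y) and
    1-(x+y), and the theory of real power series then applies to real and imaginary parts
    separately. *)
Definition is_CPS (u : nat -> C) (z : R) (l : C) : Prop :=
  is_pseries (fun n => Re (u n)) z (Re l) /\
  is_pseries (fun n => Im (u n)) z (Im l).

Definition CPS (u : nat -> C) (z : R) : C :=
  (PSeries (fun n => Re (u n)) z, PSeries (fun n => Im (u n)) z).

Definition CPS_derive (u : nat -> C) (n : nat) : C :=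
  (RtoC (INR (S n)) * u (S n))%C.

(** Multiplication by the variable, on coefficients; with [CPS_derive] it turns each term of the
    Gauss equation into a power series. *)
Definition CPS_shift (u : nat -> C) (n : nat) : C :=
  match n with O => RtoC 0 | S m => u m end.

Lemma is_CPS_ext (u v : nat -> C) (z : R) (l : C) :
  (forall n, u n = v n) -> is_CPS u z l -> is_CPS v z l.
Proof.
  intros E [H1 H2]; split; (eapply is_pseries_ext; [ | eassumption ]);
    intros n; simpl; now rewrite E.
Qed.

Lemma is_CPS_unique (u : nat -> C) (z : R) (l : C) :
  is_CPS u z l -> CPS u z = l.
Proof.
  intros [H1 H2]. unfold CPS.
  rewrite (is_pseries_unique _ _ _ H1), (is_pseries_unique _ _ _ H2).
  now destruct l.
Qed.

Lemma is_CPS_plus (u v : nat -> C) (z : R) (l m : C) :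
  is_CPS u z l -> is_CPS v z m -> is_CPS (fun n => u n + v n)%C z (l + m).
Proof. intros [H1 H2] [H3 H4]; split; now apply @is_pseries_plus. Qed.

Lemma is_CPS_scal (k : C) (u : nat -> C) (z : R) (l : C) :
  is_CPS u z l -> is_CPS (fun n => k * u n)%C z (k * l).
Proof.
  intros [H1 H2]; destruct k as [r s]; split; simpl.
  - apply (is_pseries_minus (V := R_NormedModule) (fun n => r * Re (u n))
      (fun n => s * Im (u n)));
      apply (is_pseries_scal (V := R_NormedModule)); auto; apply Rmult_comm.
  - apply (is_pseries_plus (V := R_NormedModule) (fun n => r * Im (u n))
      (fun n => s * Re (u n)));
      apply (is_pseries_scal (V := R_NormedModule)); auto; apply Rmult_comm.
Qed.

Lemma is_CPS_shift (u : nat -> C) (z : R) (l : C) :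
  is_CPS u z l -> is_CPS (CPS_shift u) z (RtoC z * l).
Proof.
  intros [H1 H2]; apply is_pseries_incr_1 in H1; apply is_pseries_incr_1 in H2.
  split; simpl.
  - replace (z * fst l - 0 * snd l) with (scal z (fst l))
      by (unfold scal; simpl; unfold mult; simpl; ring).
    eapply is_pseries_ext; [ | exact H1 ]; now intros [ | n].
  - replace (z * snd l + 0 * fst l) with (scal z (snd l))
      by (unfold scal; simpl; unfold mult; simpl; ring).
    eapply is_pseries_ext; [ | exact H2 ]; now intros [ | n].
Qed.

Lemma is_CPS_zero (z : R) : is_CPS (fun _ => RtoC 0) z 0.
Proof.
  assert (H : is_pseries (fun _ : nat => 0) z 0).
  { apply is_pseries_R.
    apply (is_series_ext (fun _ : nat => 0)); [intros n; symmetry; apply Rmult_0_l | ].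
    apply is_series_Reals. intros e He. exists O. intros n _.
    replace (sum_f_R0 (fun _ : nat => 0) n) with 0
      by (induction n; simpl; lra).
    now rewrite R_dist_eq. }
  now split.
Qed.

(** Strictly inside the radius of convergence, rather than mere convergence at [z]: this condition
    survives termwise differentiation, which leaves the radius unchanged. *)
Definition CPS_cv (u : nat -> C) (z : R) : Prop :=
  Rbar_lt (Rabs z) (CV_radius (fun n => Re (u n))) /\
  Rbar_lt (Rabs z) (CV_radius (fun n => Im (u n))).

Lemma CPS_cv_correct (u : nat -> C) (z : R) :
  CPS_cv u z -> is_CPS u z (CPS u z).
Proof.
  intros [H1 H2]; split; simpl; apply PSeries_correct; now apply CV_radius_inside.
Qed.

Lemma Re_CPS_derive (u : nat -> C) (n : nat) :
  Re (CPS_derive u n) = PS_derive (fun m => Re (u m)) n.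
Proof. unfold CPS_derive, PS_derive, Cmult, RtoC, Re; cbn [fst snd]; ring. Qed.

Lemma Im_CPS_derive (u : nat -> C) (n : nat) :
  Im (CPS_derive u n) = PS_derive (fun m => Im (u m)) n.
Proof. unfold CPS_derive, PS_derive, Cmult, RtoC, Im; cbn [fst snd]; ring. Qed.

Lemma CPS_cv_derive (u : nat -> C) (z : R) :
  CPS_cv u z -> CPS_cv (CPS_derive u) z.
Proof.
  intros [H1 H2]; split.
  - now rewrite (CV_radius_ext _ _ (Re_CPS_derive u)), CV_radius_derive.
  - now rewrite (CV_radius_ext _ _ (Im_CPS_derive u)), CV_radius_derive.
Qed.

Lemma is_derive_CPS (u : nat -> C) (z : R) :
  CPS_cv u z -> is_derive_RC (CPS u) z (CPS (CPS_derive u) z).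
Proof.
  intros [H1 H2]; unfold CPS at 2; split; simpl.
  - rewrite (PSeries_ext _ _ _ (Re_CPS_derive u)). now apply is_derive_PSeries.
  - rewrite (PSeries_ext _ _ _ (Im_CPS_derive u)). now apply is_derive_PSeries.
Qed.

(** * The Gauss hypergeometric equation *)

Definition hyp_coef (q r g : C) (n : nat) : C :=
  (Cpochhammer q n * Cpochhammer r n
     / (Cpochhammer g n * RtoC (INR (fact n))))%C.

Lemma hyp2F1_CPS (q r g : C) (z : R) :
  hyp2F1 q r g (RtoC z) = CPS (hyp_coef q r g) z.
Proof.
  unfold hyp2F1, CSeries, CPS, PSeries.
  f_equal; apply Series_ext; intros n; fold (hyp_coef q r g n);
    rewrite <- RtoC_pow; simpl; ring.
Qed.

Lemma Cpochhammer_neq_0 (g : C) (n : nat) :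
  (forall m : nat, g + RtoC (INR m) <> 0)%C -> Cpochhammer g n <> 0.
Proof.
  intros Hg; induction n as [ | n IH]; simpl.
  - intros H; apply RtoC_inj in H; lra.
  - now apply Cmult_neq_0.
Qed.

(** The ratio of consecutive coefficients, cleared of denominators; both the growth bound and the
    differential equation rest on it. *)
Lemma hyp_coef_S (q r g : C) (n : nat) :
  (forall m : nat, g + RtoC (INR m) <> 0)%C ->
  ((RtoC (INR n) + 1) * (g + RtoC (INR n)) * hyp_coef q r g (S n)
   = (q + RtoC (INR n)) * (r + RtoC (INR n)) * hyp_coef q r g n)%C.
Proof.
  intros Hg. unfold hyp_coef.
  assert (F : RtoC (INR (fact n)) <> 0)
    by (intros H; apply RtoC_inj in H; now apply (INR_fact_neq_0 n)).
  assert (N : (RtoC (INR n) + 1)%C <> 0).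
  { rewrite <- RtoC_plus. intros H; apply RtoC_inj in H.
    pose proof (pos_INR n); lra. }
  change (fact (S n)) with ((S n) * fact n)%nat.
  rewrite mult_INR, S_INR, RtoC_mult, RtoC_plus. cbn [Cpochhammer].
  field. repeat split; auto using Cpochhammer_neq_0.
Qed.

Lemma eventually_decreasing_bounded (v : nat -> R) (N : nat) :
  (forall n, (N <= n)%nat -> v (S n) <= v n) -> exists M, forall n, v n <= M.
Proof.
  revert v; induction N as [ | N IH]; intros v H.
  - exists (v O). intros n; induction n as [ | n IHn]; [lra | ].
    specialize (H n ltac:(lia)); lra.
  - destruct (IH (fun n => v (S n))) as [M HM].
    { intros n Hn; apply H; lia. }
    exists (Rmax (v O) M). intros [ | n]; [apply Rmax_l | ].
    eapply Rle_trans; [apply HM | apply Rmax_r].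
Qed.

(* The ratio of consecutive coefficients tends to 1 in modulus, so
   [Cmod u_n * rho ^ n] is eventually nonincreasing; arguing with an inequality
   rather than a limit of ratios covers terminating series as well. *)
Lemma hyp_coef_bounded (q r g : C) (rho : R) :
  (forall m : nat, g + RtoC (INR m) <> 0)%C -> 0 < rho < 1 ->
  exists M, forall n, Cmod (hyp_coef q r g n) * rho ^ n <= M.
Proof.
  intros Hg Hrho.
  set (Q := Cmod q); set (S0 := Cmod r); set (G := Cmod g).
  assert (HQ : 0 <= Q) by apply Cmod_ge_0.
  assert (HS : 0 <= S0) by apply Cmod_ge_0.
  assert (HG : 0 <= G) by apply Cmod_ge_0.
  (* [K] dominates the lower-order coefficients in the comparison of rho (Q+n)(S0+n) with
     (n+1)(n-G). Once (1-rho) n exceeds [K], also n > 1 and n > G. *)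
  set (K := Q + S0 + 2 * G + Q * S0 + 1).
  destruct (INR_unbounded (K / (1 - rho))) as [N HN].
  apply (eventually_decreasing_bounded _ N). intros n Hn.
  assert (HnK : K < (1 - rho) * INR n).
  { apply le_INR in Hn. apply Rlt_le_trans with ((1 - rho) * INR N).
    - replace K with ((1 - rho) * (K / (1 - rho))) by (field; lra).
      apply Rmult_lt_compat_l; lra.
    - apply Rmult_le_compat_l; lra. }
  set (x := INR n) in *.
  assert (HQS : 0 <= Q * S0) by now apply Rmult_le_pos.
  assert (Hx : 1 < x) by (unfold K in HnK; nra).
  assert (HxG : G < x) by (unfold K in HnK; nra).
  assert (Cx : Cmod (RtoC x) = x) by (rewrite Cmod_R; apply Rabs_pos_eq; lra).
  assert (Bq : Cmod (q + RtoC x) <= Q + x)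
    by (rewrite <- Cx at 2; apply Cmod_triangle).
  assert (Br : Cmod (r + RtoC x) <= S0 + x)
    by (rewrite <- Cx at 2; apply Cmod_triangle).
  assert (Bg : x - G <= Cmod (g + RtoC x)).
  { pose proof (Cmod_triangle (g + RtoC x) (- g)) as T.
    replace (g + RtoC x + - g)%C with (RtoC x) in T by ring.
    rewrite Cmod_opp, Cx in T. unfold G; lra. }
  assert (E := f_equal Cmod (hyp_coef_S q r g n Hg)). fold x in E.
  rewrite !Cmod_mult in E.
  replace (Cmod (RtoC x + 1)) with (x + 1) in E
    by (rewrite <- RtoC_plus, Cmod_R, Rabs_pos_eq; lra).
  set (u1 := Cmod (hyp_coef q r g (S n))) in *.
  set (u0 := Cmod (hyp_coef q r g n)) in *.
  assert (H1 : 0 <= u1) by apply Cmod_ge_0.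
  assert (H0 : 0 <= u0) by apply Cmod_ge_0.
  assert (Pq := Cmod_ge_0 (q + RtoC x)). assert (Pr := Cmod_ge_0 (r + RtoC x)).
  set (D := (x + 1) * (x - G)).
  assert (HD : 0 < D) by (apply Rmult_lt_0_compat; lra).
  assert (I1 : D * u1 <= (Q + x) * (S0 + x) * u0).
  { apply Rle_trans with ((x + 1) * Cmod (g + RtoC x) * u1).
    - apply Rmult_le_compat_r; auto. apply Rmult_le_compat_l; lra.
    - rewrite E. apply Rmult_le_compat_r; auto. now apply Rmult_le_compat. }
  (* The leading terms leave a surplus (1-rho) x^2. Since x > 1, all other terms together are at
     most K x, which the surplus absorbs. *)
  assert (I2 : rho * ((Q + x) * (S0 + x)) <= D).
  { unfold D. unfold K in HnK.
    assert (T1 : rho * (Q * S0) <= Q * S0 * x) by nra.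
    assert (T2 : rho * ((Q + S0) * x) <= (Q + S0) * x) by nra.
    assert (T3 : G <= G * x) by nra.
    assert (T4 : (Q + S0 + 2 * G + Q * S0 + 1) * x <= (1 - rho) * x * x) by nra.
    nra. }
  (* The ratio bound without division, hence also valid when [u0] vanishes. *)
  assert (I3 : rho * u1 <= u0).
  { apply Rmult_le_reg_l with D; [exact HD | ].
    apply Rle_trans with (rho * ((Q + x) * (S0 + x)) * u0); [nra | ].
    now apply Rmult_le_compat_r. }
  simpl. assert (0 < rho ^ n) by (apply pow_lt; lra). nra.
Qed.

(** With rho the midpoint of |z| and 1, the terms at rho are bounded, so the radius is at least rho
    > |z|. *)
Lemma CPS_cv_hyp_coef (q r g : C) (z : R) :
  (forall m : nat, g + RtoC (INR m) <> 0)%C -> Rabs z < 1 ->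
  CPS_cv (hyp_coef q r g) z.
Proof.
  intros Hg Hz. set (rho := (1 + Rabs z) / 2).
  assert (Hr : 0 < rho < 1) by (pose proof (Rabs_pos z); unfold rho; lra).
  destruct (hyp_coef_bounded q r g rho Hg Hr) as [M HM].
  assert (B : forall w : C, Rabs (Re w) <= Cmod w /\ Rabs (Im w) <= Cmod w).
  { intros w; pose proof (Rmax_Cmod w) as H; split;
      (eapply Rle_trans; [ | exact H ]); [apply Rmax_l | apply Rmax_r]. }
  split; (eapply Rbar_lt_le_trans with (Finite rho); [simpl; unfold rho; lra | ]);
    apply CV_radius_bounded; exists M; intros n;
    (eapply Rle_trans; [ | apply (HM n) ]);
    rewrite Rabs_mult, (Rabs_pos_eq (rho ^ n)) by (apply pow_le; lra);
    (apply Rmult_le_compat_r; [apply pow_le; lra | apply B]).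
Qed.

(** The left side is one power series whose coefficient at z^n is (n+1)(g+n) u_(n+1) - (q+n)(r+n)
    u_n, which is zero by the recurrence. *)
Lemma hypergeometric_equation (q r g : C) (z : R) (u := hyp_coef q r g) :
  (forall m : nat, g + RtoC (INR m) <> 0)%C -> Rabs z < 1 ->
  (RtoC z * (1 - RtoC z) * CPS (CPS_derive (CPS_derive u)) z
   + (g - (q + r + 1) * RtoC z) * CPS (CPS_derive u) z
   - q * r * CPS u z = 0)%C.
Proof.
  intros Hg Hz.
  assert (U0 := CPS_cv_hyp_coef q r g z Hg Hz). fold u in U0.
  assert (U1 := CPS_cv_derive _ _ U0). assert (U2 := CPS_cv_derive _ _ U1).
  apply CPS_cv_correct in U0. apply CPS_cv_correct in U1. apply CPS_cv_correct in U2.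
  set (l0 := CPS u z) in *. set (l1 := CPS (CPS_derive u) z) in *.
  set (l2 := CPS (CPS_derive (CPS_derive u)) z) in *.
  assert (V2 := is_CPS_shift _ _ _ U2). assert (W2 := is_CPS_shift _ _ _ V2).
  assert (V1 := is_CPS_shift _ _ _ U1).
  assert (T := is_CPS_plus _ _ _ _ _ (is_CPS_plus _ _ _ _ _ V2
     (is_CPS_scal (-1) _ _ _ W2)) (is_CPS_plus _ _ _ _ _
     (is_CPS_plus _ _ _ _ _ (is_CPS_scal g _ _ _ U1)
        (is_CPS_scal (- (q + r + 1)) _ _ _ V1)) (is_CPS_scal (- (q * r)) _ _ _ U0))).
  assert (Z : is_CPS (fun _ => RtoC 0) z
    (RtoC z * l2 + -1 * (RtoC z * (RtoC z * l2)) +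
     (g * l1 + - (q + r + 1) * (RtoC z * l1) + - (q * r) * l0))%C).
  { eapply is_CPS_ext; [ | exact T ]. clear - Hg. intros n. simpl.
    pose proof (hyp_coef_S q r g n Hg) as E. fold u in E.
    (* The term in z^2 shifts twice, so the indices 0 and 1 are separate cases. *)
    destruct n as [ | [ | n]]; unfold CPS_shift, CPS_derive;
      rewrite ?S_INR, ?RtoC_plus in *;
      [change (INR 0) with 0 in * | change (INR 0) with 0 in * | ].
    all: match type of E with _ = ?X =>
      match goal with |- _ = RtoC 0 =>
        transitivity (X - X)%C; [rewrite <- E at 1 | ]; ring end end. }
  apply is_CPS_unique in Z. rewrite (is_CPS_unique _ _ _ (is_CPS_zero z)) in Z.
  rewrite Z at 1. ring.
Qed.

(** * Functions separated in the coordinates [x / (x + y)] and [x + y] *)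

(** The interval (0,1) is where both x/(x+y) and x+y take their values on the triangle. *)
Definition twice_derivable_with (f f1 f2 : R -> C) : Prop :=
  forall t, 0 < t < 1 -> is_derive_RC f t (f1 t) /\ is_derive_RC f1 t (f2 t).

Ltac push_RtoC :=
  repeat (progress
    rewrite ?RtoC_plus, ?RtoC_minus, ?RtoC_mult, ?RtoC_opp, ?RtoC_pow).

Lemma RtoC_neq_0 (x : R) : x <> 0 -> RtoC x <> 0.
Proof. intros H E; now apply H, RtoC_inj. Qed.

Lemma in_triangle_locally_x (x y : R) :
  in_triangle x y -> locally x (fun t => in_triangle t y).
Proof.
  intros (H1 & H2 & H3).
  assert (He : 0 < Rmin x (1 - x - y)) by (apply Rmin_pos; lra).
  exists (mkposreal _ He). intros t Ht.
  unfold ball in Ht; simpl in Ht; unfold AbsRing_ball, abs, minus, plus, opp in Ht;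
    simpl in Ht.
  pose proof (Rmin_l x (1 - x - y)). pose proof (Rmin_r x (1 - x - y)).
  apply Rabs_def2 in Ht. unfold in_triangle; lra.
Qed.

Lemma in_triangle_locally_y (x y : R) :
  in_triangle x y -> locally y (fun t => in_triangle x t).
Proof.
  intros (H1 & H2 & H3).
  assert (T : in_triangle y x) by (unfold in_triangle; lra).
  generalize (in_triangle_locally_x _ _ T). apply filter_imp.
  unfold in_triangle; intros; lra.
Qed.

(** Chain rule for t = x/(x+y) and s = x+y: here t_x = y/s^2 and s_x = 1, and in the companion lemma
    t_y = -x/s^2 and s_y = 1. *)
Lemma is_derive_sep_x (P P1 f f1 : R -> C) (x y : R) :
  in_triangle x y ->
  is_derive_RC P (x / (x + y))%R (P1 (x / (x + y))%R) ->
  is_derive_RC f (x + y)%R (f1 (x + y)%R) ->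
  is_derive_RC (fun u => P (u / (u + y))%R * f (u + y)%R)%C x
    (RtoC (y / (x + y) ^ 2)%R * (P1 (x / (x + y))%R * f (x + y)%R)
     + P (x / (x + y))%R * f1 (x + y)%R).
Proof.
  intros (H1 & H2 & H3) HP Hf.
  eapply is_derive_RC_eq.
  - apply (is_derive_RC_mult (fun u => P (u / (u + y))%R) (fun u => f (u + y)%R)).
    + apply (is_derive_RC_comp P (fun u => u / (u + y)) x (P1 (x / (x + y))) (y / (x + y) ^ 2));
        [exact HP | auto_derive; [lra | field; lra]].
    + apply (is_derive_RC_comp f (fun u => u + y) x (f1 (x + y)) 1);
        [exact Hf | auto_derive; auto; ring].
  - ring.
Qed.

Lemma is_derive_sep_y (P P1 f f1 : R -> C) (x y : R) :
  in_triangle x y ->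
  is_derive_RC P (x / (x + y))%R (P1 (x / (x + y))%R) ->
  is_derive_RC f (x + y)%R (f1 (x + y)%R) ->
  is_derive_RC (fun u => P (x / (x + u))%R * f (x + u)%R)%C y
    (RtoC (- x / (x + y) ^ 2)%R * (P1 (x / (x + y))%R * f (x + y)%R)
     + P (x / (x + y))%R * f1 (x + y)%R).
Proof.
  intros (H1 & H2 & H3) HP Hf.
  eapply is_derive_RC_eq.
  - apply (is_derive_RC_mult (fun u => P (x / (x + u))%R) (fun u => f (x + u)%R)).
    + apply (is_derive_RC_comp P (fun u => x / (x + u)) y (P1 (x / (x + y))) (- x / (x + y) ^ 2));
        [exact HP | auto_derive; [lra | field; lra]].
    + apply (is_derive_RC_comp f (fun u => x + u) y (f1 (x + y)) 1);
        [exact Hf | auto_derive; auto; ring].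
  - ring.
Qed.

Lemma in_triangle_ratio (x y : R) : in_triangle x y -> 0 < x / (x + y) < 1.
Proof.
  intros (H1 & H2 & H3); split; [apply Rdiv_lt_0_compat; lra | ].
  apply Rmult_lt_reg_r with (x + y); [lra | ].
  unfold Rdiv; rewrite Rmult_assoc, Rinv_l by lra; lra.
Qed.

(** * Second-order partial derivatives of a separated function, and [L3] and [L] acting on it *)

Section Separated.

Variables (P P1 P2 f f1 f2 : R -> C) (g : fun2).
Hypothesis HP : twice_derivable_with P P1 P2.
Hypothesis Hf : twice_derivable_with f f1 f2.
Hypothesis Hg : forall x y, in_triangle x y ->
  g x y = (P (x / (x + y))%R * f (x + y)%R)%C.

Definition sep_dx (x y : R) : C :=
  (RtoC (y / (x + y) ^ 2)%R * (P1 (x / (x + y))%R * f (x + y)%R)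
   + P (x / (x + y))%R * f1 (x + y)%R)%C.

Definition sep_dy (x y : R) : C :=
  (RtoC (- x / (x + y) ^ 2)%R * (P1 (x / (x + y))%R * f (x + y)%R)
   + P (x / (x + y))%R * f1 (x + y)%R)%C.

(** The product formula for [g] is known only on the triangle; as the triangle is open, it holds
    near the point, which suffices for the derivative. *)
Lemma sep_is_derive_x (x y : R) :
  in_triangle x y -> is_derive_RC (fun t => g t y) x (sep_dx x y).
Proof.
  intros T.
  apply (is_derive_RC_ext_loc (fun u => P (u / (u + y))%R * f (u + y)%R)%C).
  - generalize (in_triangle_locally_x _ _ T); apply filter_imp.
    intros t Ht; now rewrite Hg.
  - apply is_derive_sep_x; auto; [apply HP, in_triangle_ratio, T | ].
    apply Hf; unfold in_triangle in T; lra.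
Qed.

Lemma sep_is_derive_y (x y : R) :
  in_triangle x y -> is_derive_RC (fun t => g x t) y (sep_dy x y).
Proof.
  intros T.
  apply (is_derive_RC_ext_loc (fun u => P (x / (x + u))%R * f (x + u)%R)%C).
  - generalize (in_triangle_locally_y _ _ T); apply filter_imp.
    intros t Ht; now rewrite Hg.
  - apply is_derive_sep_y; auto; [apply HP, in_triangle_ratio, T | ].
    apply Hf; unfold in_triangle in T; lra.
Qed.

Lemma dx_sep (x y : R) : in_triangle x y -> dx g x y = sep_dx x y.
Proof. intros T; now apply is_derive_RC_unique, sep_is_derive_x. Qed.

Lemma dy_sep (x y : R) : in_triangle x y -> dy g x y = sep_dy x y.
Proof. intros T; now apply is_derive_RC_unique, sep_is_derive_y. Qed.

(** Both first partial derivatives have the form h P1 f + P f1, with h equal to t_x or t_y. Each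
    product is again separated, so one lemma with [h] free gives both second derivatives in this
    direction. *)
Lemma sep_is_derive_comb_x (h : R -> R) (m x y : R) :
  in_triangle x y -> is_derive h x m ->
  is_derive_RC (fun u => RtoC (h u) * (P1 (u / (u + y))%R * f (u + y)%R)
                         + P (u / (u + y))%R * f1 (u + y)%R)%C x
    (RtoC m * (P1 (x / (x + y))%R * f (x + y)%R)
     + RtoC (h x) * (RtoC (y / (x + y) ^ 2)%R * (P2 (x / (x + y))%R * f (x + y)%R)
                     + P1 (x / (x + y))%R * f1 (x + y)%R)
     + (RtoC (y / (x + y) ^ 2)%R * (P1 (x / (x + y))%R * f1 (x + y)%R)
        + P (x / (x + y))%R * f2 (x + y)%R)).
Proof.
  intros T Hm.
  assert (Ht := HP _ (in_triangle_ratio _ _ T)).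
  assert (Hs : 0 < x + y < 1) by (unfold in_triangle in T; lra).
  apply Hf in Hs.
  apply is_derive_RC_plus;
    [apply (is_derive_RC_mult (fun u => RtoC (h u))) | ].
  - now apply is_derive_RC_RtoC.
  - now apply is_derive_sep_x.
  - now apply is_derive_sep_x.
Qed.

Lemma sep_is_derive_comb_y (h : R -> R) (m x y : R) :
  in_triangle x y -> is_derive h y m ->
  is_derive_RC (fun u => RtoC (h u) * (P1 (x / (x + u))%R * f (x + u)%R)
                         + P (x / (x + u))%R * f1 (x + u)%R)%C y
    (RtoC m * (P1 (x / (x + y))%R * f (x + y)%R)
     + RtoC (h y) * (RtoC (- x / (x + y) ^ 2)%R * (P2 (x / (x + y))%R * f (x + y)%R)
                     + P1 (x / (x + y))%R * f1 (x + y)%R)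
     + (RtoC (- x / (x + y) ^ 2)%R * (P1 (x / (x + y))%R * f1 (x + y)%R)
        + P (x / (x + y))%R * f2 (x + y)%R)).
Proof.
  intros T Hm.
  assert (Ht := HP _ (in_triangle_ratio _ _ T)).
  assert (Hs : 0 < x + y < 1) by (unfold in_triangle in T; lra).
  apply Hf in Hs.
  apply is_derive_RC_plus;
    [apply (is_derive_RC_mult (fun u => RtoC (h u))) | ].
  - now apply is_derive_RC_RtoC.
  - now apply is_derive_sep_y.
  - now apply is_derive_sep_y.
Qed.

Lemma sep_is_derive_xx (x y : R) : in_triangle x y ->
  is_derive_RC (fun t => dx g t y) x
    (RtoC (- 2 * y / (x + y) ^ 3)%R * (P1 (x / (x + y))%R * f (x + y)%R)
     + RtoC (y / (x + y) ^ 2)%R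
       * (RtoC (y / (x + y) ^ 2)%R * (P2 (x / (x + y))%R * f (x + y)%R)
          + P1 (x / (x + y))%R * f1 (x + y)%R)
     + (RtoC (y / (x + y) ^ 2)%R * (P1 (x / (x + y))%R * f1 (x + y)%R)
        + P (x / (x + y))%R * f2 (x + y)%R)).
Proof.
  intros T. eapply is_derive_RC_ext_loc.
  - generalize (in_triangle_locally_x _ _ T); apply filter_imp.
    intros t Ht; symmetry; now apply dx_sep.
  - apply (sep_is_derive_comb_x (fun u => y / (u + y) ^ 2)); auto.
    unfold in_triangle in T. auto_derive; [nra | field; lra].
Qed.

(** Serves the differentiability claim for [dx g]; the operators take the mixed derivative in the
    order [dx (dy g)]. *)
Lemma sep_is_derive_xy (x y : R) : in_triangle x y ->
  is_derive_RC (fun t => dx g x t) y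
    (RtoC ((x - y) / (x + y) ^ 3)%R * (P1 (x / (x + y))%R * f (x + y)%R)
     + RtoC (y / (x + y) ^ 2)%R
       * (RtoC (- x / (x + y) ^ 2)%R * (P2 (x / (x + y))%R * f (x + y)%R)
          + P1 (x / (x + y))%R * f1 (x + y)%R)
     + (RtoC (- x / (x + y) ^ 2)%R * (P1 (x / (x + y))%R * f1 (x + y)%R)
        + P (x / (x + y))%R * f2 (x + y)%R)).
Proof.
  intros T. eapply is_derive_RC_ext_loc.
  - generalize (in_triangle_locally_y _ _ T); apply filter_imp.
    intros t Ht; symmetry; now apply dx_sep.
  - apply (sep_is_derive_comb_y (fun u => u / (x + u) ^ 2)); auto.
    unfold in_triangle in T. auto_derive; [nra | field; lra].
Qed.

Lemma sep_is_derive_yx (x y : R) : in_triangle x y ->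
  is_derive_RC (fun t => dy g t y) x
    (RtoC ((x - y) / (x + y) ^ 3)%R * (P1 (x / (x + y))%R * f (x + y)%R)
     + RtoC (- x / (x + y) ^ 2)%R
       * (RtoC (y / (x + y) ^ 2)%R * (P2 (x / (x + y))%R * f (x + y)%R)
          + P1 (x / (x + y))%R * f1 (x + y)%R)
     + (RtoC (y / (x + y) ^ 2)%R * (P1 (x / (x + y))%R * f1 (x + y)%R)
        + P (x / (x + y))%R * f2 (x + y)%R)).
Proof.
  intros T. eapply is_derive_RC_ext_loc.
  - generalize (in_triangle_locally_x _ _ T); apply filter_imp.
    intros t Ht; symmetry; now apply dy_sep.
  - apply (sep_is_derive_comb_x (fun u => - u / (u + y) ^ 2)); auto.
    unfold in_triangle in T. auto_derive; [nra | field; lra].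
Qed.

Lemma sep_is_derive_yy (x y : R) : in_triangle x y ->
  is_derive_RC (fun t => dy g x t) y
    (RtoC (2 * x / (x + y) ^ 3)%R * (P1 (x / (x + y))%R * f (x + y)%R)
     + RtoC (- x / (x + y) ^ 2)%R
       * (RtoC (- x / (x + y) ^ 2)%R * (P2 (x / (x + y))%R * f (x + y)%R)
          + P1 (x / (x + y))%R * f1 (x + y)%R)
     + (RtoC (- x / (x + y) ^ 2)%R * (P1 (x / (x + y))%R * f1 (x + y)%R)
        + P (x / (x + y))%R * f2 (x + y)%R)).
Proof.
  intros T. eapply is_derive_RC_ext_loc.
  - generalize (in_triangle_locally_y _ _ T); apply filter_imp.
    intros t Ht; symmetry; now apply dy_sep.
  - apply (sep_is_derive_comb_y (fun u => - x / (x + u) ^ 2)); auto.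
    unfold in_triangle in T. auto_derive; [nra | field; lra].
Qed.

Lemma sep_twice_partially_derivable : twice_partially_derivable g.
Proof.
  repeat split; eapply is_derive_RC_ex_derive;
    [apply sep_is_derive_x | apply sep_is_derive_y
    | apply sep_is_derive_xx | apply sep_is_derive_xy
    | apply sep_is_derive_yx | apply sep_is_derive_yy]; assumption.
Qed.

(** The field d_x - d_y kills s and equals (1/s) d_t, while xy = s^2 t(1-t) and (a+1)y - (b+1)x = s
    (a+1 - (a+b+2)t); all powers of s cancel. *)
Lemma L3_sep (a b x y : R) (t := (x / (x + y))%R) (s := (x + y)%R) :
  in_triangle x y ->
  L3 a b g x y
  = ((RtoC t * (1 - RtoC t) * P2 t
      + (RtoC a + 1 - (RtoC a + RtoC b + 2) * RtoC t) * P1 t) * f s)%C.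
Proof.
  intros T. unfold L3, subop, scalop, addop, mulop, compop, oppop.
  change (dx (dx g) x y) with (Derive_RC (fun t => dx g t y) x).
  change (dy (dy g) x y) with (Derive_RC (fun t => dy g x t) y).
  change (dx (dy g) x y) with (Derive_RC (fun t => dy g t y) x).
  rewrite (is_derive_RC_unique _ _ _ (sep_is_derive_xx _ _ T)).
  rewrite (is_derive_RC_unique _ _ _ (sep_is_derive_yx _ _ T)).
  rewrite (is_derive_RC_unique _ _ _ (sep_is_derive_yy _ _ T)).
  rewrite dx_sep, dy_sep by assumption. unfold sep_dx, sep_dy.
  unfold in_triangle in T.
  fold t s.
  (* With [x] and [y] expressed through independent [s] and [t], the claim is a rational identity in
     which the values of the factors and their derivatives are atoms. *)
  assert (Ex : x = (s * t)%R) by (unfold t, s; field; lra).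
  assert (Ey : y = (s * (1 - t))%R) by (unfold t, s; field; lra).
  assert (Hs : s <> 0) by (unfold s; lra).
  clearbody s t. subst x y. apply RtoC_neq_0 in Hs as Hs'.
  rewrite !RtoC_div by (repeat apply pow_nonzero; assumption).
  push_RtoC. field. assumption.
Qed.

(** Since x d_x + y d_y = s d_s, the terms of top degree give -s^2 d_s^2 - (a+b+c+3) s d_s. In the
    rest the mixed s,t derivatives cancel, leaving s d_s^2 + (a+b+2) d_s and [L3] divided by s. *)
Lemma L_sep (a b c x y : R) (t := (x / (x + y))%R) (s := (x + y)%R) :
  in_triangle x y ->
  L a b c g x y
  = (P t * (RtoC s * (1 - RtoC s) * f2 s
            + (RtoC a + RtoC b + 2 - (RtoC a + RtoC b + RtoC c + 3) * RtoC s) * f1 s)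
     + L3 a b g x y / RtoC s)%C.
Proof.
  intros T. rewrite L3_sep by assumption.
  unfold L, subop, addop, mulop, compop, oppop.
  change (dx (dx g) x y) with (Derive_RC (fun t => dx g t y) x).
  change (dy (dy g) x y) with (Derive_RC (fun t => dy g x t) y).
  change (dx (dy g) x y) with (Derive_RC (fun t => dy g t y) x).
  rewrite (is_derive_RC_unique _ _ _ (sep_is_derive_xx _ _ T)).
  rewrite (is_derive_RC_unique _ _ _ (sep_is_derive_yx _ _ T)).
  rewrite (is_derive_RC_unique _ _ _ (sep_is_derive_yy _ _ T)).
  rewrite dx_sep, dy_sep by assumption. unfold sep_dx, sep_dy.
  unfold in_triangle in T.
  fold t s.
  assert (Ex : x = (s * t)%R) by (unfold t, s; field; lra).
  assert (Ey : y = (s * (1 - t))%R) by (unfold t, s; field; lra).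
  assert (Hs : s <> 0) by (unfold s; lra).
  clearbody s t. subst x y. apply RtoC_neq_0 in Hs as Hs'.
  rewrite !RtoC_div by (repeat apply pow_nonzero; assumption).
  push_RtoC. field. assumption.
Qed.

End Separated.

(** * The operators [C34] and [C12] on separated functions *)

(** [C12] applies [C234] to X3 g and (X3 - 1) g as well. These stay separated, with [f] multiplied
    by 1 - s and by -s, the two instances of r + m s used below. *)
Lemma twice_derivable_affine_mult (r m : R) (f f1 f2 : R -> C) :
  twice_derivable_with f f1 f2 ->
  twice_derivable_with (fun s => RtoC (r + m * s) * f s)%C
    (fun s => RtoC m * f s + RtoC (r + m * s) * f1 s)%C
    (fun s => 2 * RtoC m * f1 s + RtoC (r + m * s) * f2 s)%C.
Proof.
  intros Hf s Hs. destruct (Hf s Hs) as [D1 D2].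
  assert (A : is_derive_RC (fun s => RtoC (r + m * s)) s (RtoC m)).
  { apply is_derive_RC_RtoC. auto_derive; auto; ring. }
  split; eapply is_derive_RC_eq.
  - apply is_derive_RC_mult; [exact A | exact D1].
  - reflexivity.
  - apply is_derive_RC_plus; apply is_derive_RC_mult;
      [apply is_derive_RC_const | exact D1 | exact A | exact D2].
  - cbv beta. ring.
Qed.

(** The equation for [P] says that [L3] multiplies [g] by -lambda, and [C34] carries [L3] with a
    minus sign. *)
Lemma C34_sep (P P1 P2 f f1 f2 : R -> C) (g : fun2) (a b x y : R)
  (t := (x / (x + y))%R) (s := (x + y)%R) (lambda : C) :
  twice_derivable_with P P1 P2 -> twice_derivable_with f f1 f2 ->
  (forall x y, in_triangle x y -> g x y = (P (x / (x + y))%R * f (x + y)%R)%C) ->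
  in_triangle x y ->
  (RtoC t * (1 - RtoC t) * P2 t
   + (RtoC a + 1 - (RtoC a + RtoC b + 2) * RtoC t) * P1 t + lambda * P t = 0)%C ->
  C34 a b g x y = ((lambda + RtoC (((a + b + 1) ^ 2 - 1) / 4)) * g x y)%C.
Proof.
  intros HP Hf Hg T E. unfold C34, addop, oppop, scalop, mulop.
  rewrite (L3_sep P P1 P2 f f1 f2 g HP Hf Hg a b x y T).
  fold t s. rewrite (Hg x y T). fold t s.
  match type of E with (?A + _)%C = _ =>
    replace A with (- (lambda * P t))%C end; [ring | ].
  rewrite <- (Cplus_0_l (- _)), <- E. ring.
Qed.

(* [L3] cancels in [C12], which therefore acts on the factor in [x + y] alone. *)
Lemma C12_sep (P P1 P2 f f1 f2 : R -> C) (g : fun2) (a b c d x y : R)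
  (s := (x + y)%R)
  (e := (RtoC a + RtoC b + 2 - (RtoC a + RtoC b + RtoC c + 3) * RtoC s)%C)
  (w := (RtoC a + RtoC d + 2)%C) :
  twice_derivable_with P P1 P2 -> twice_derivable_with f f1 f2 ->
  (forall x y, in_triangle x y -> g x y = (P (x / (x + y))%R * f (x + y)%R)%C) ->
  in_triangle x y ->
  C12 a b c d g x y
  = (P (x / (x + y))%R *
     (RtoC s ^ 2 * (1 - RtoC s) * f2 s
      + ((w + 1) * RtoC s * (1 - RtoC s) + RtoC s * e) * f1 s
      + ((w + 1) / 2 * e
         - RtoC s * ((RtoC a + RtoC b + RtoC c + 2) ^ 2 - 1
                     + w ^ 2 - (RtoC d - RtoC b - RtoC c) ^ 2) / 4
         + ((RtoC a + RtoC b + 1) ^ 2 - 1 + w ^ 2 - 1) / 4) * f s))%C.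
Proof.
  intros HP Hf Hg T.
  assert (Hf' := twice_derivable_affine_mult 1 (-1) _ _ _ Hf).
  assert (Hf'' := twice_derivable_affine_mult 0 (-1) _ _ _ Hf).
  unfold C12, C34, C234, commutator, anticommutator, subop, scalop, X3, compop,
    addop, oppop, mulop.
  rewrite (L_sep P P1 P2 f f1 f2 g HP Hf Hg a b c x y T).
  rewrite (L_sep P P1 P2 _ _ _
    (fun x y => RtoC (1 - x - y) * g x y)%C HP Hf');
    [ | intros x' y' T'; rewrite Hg by assumption;
        replace (1 + -1 * (x' + y'))%R with (1 - x' - y')%R by ring; ring
      | exact T].
  rewrite (L_sep P P1 P2 _ _ _
    (fun x y => RtoC (1 - x - y) * g x y + - (RtoC 1 * g x y))%C HP Hf'');
    [ | intros x' y' T'; rewrite Hg by assumption; push_RtoC; ring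
      | exact T].
  (* [L3] commutes with multiplication by s, so it drops out of the commutator; half the
     anticommutator contributes +L3, against -L3 from [C34]. Expanding every occurrence lets [field]
     see this. *)
  rewrite (L3_sep P P1 P2 f f1 f2 g HP Hf Hg a b x y T).
  rewrite (L3_sep P P1 P2 _ _ _
    (fun x y => RtoC (1 - x - y) * g x y)%C HP Hf');
    [ | intros x' y' T'; rewrite Hg by assumption;
        replace (1 + -1 * (x' + y'))%R with (1 - x' - y')%R by ring; ring
      | exact T].
  rewrite (L3_sep P P1 P2 _ _ _
    (fun x y => RtoC (1 - x - y) * g x y + - (RtoC 1 * g x y))%C HP Hf'');
    [ | intros x' y' T'; rewrite Hg by assumption; push_RtoC; ring
      | exact T].
  rewrite (Hg x y T).
  assert (Hs : s <> 0) by (unfold in_triangle in T; unfold s; lra).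
  apply RtoC_neq_0 in Hs. unfold e, w. clear e w.
  replace (1 - x - y)%R with (1 - s)%R by (unfold s; ring).
  fold s. set (t := (x / s)%R). clearbody s t.
  rewrite ?RtoC_opp, !RtoC_div by lra. push_RtoC. field. exact Hs.
Qed.

(** * Derivatives of the two hypergeometric factors *)

(** Termwise derivatives, indexed by order, instead of 2F1 with raised parameters: the orders 0, 1,
    2 are then convertible with the series in the Gauss equation. *)
Definition hyp2F1_D (i : nat) (q r g : C) (z : R) : C :=
  CPS (Nat.iter i CPS_derive (hyp_coef q r g)) z.

Lemma is_derive_hyp2F1_D (i : nat) (q r g : C) (z : R) :
  (forall m : nat, g + RtoC (INR m) <> 0)%C -> Rabs z < 1 ->
  is_derive_RC (hyp2F1_D i q r g) z (hyp2F1_D (S i) q r g z).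
Proof.
  intros Hg Hz. apply is_derive_CPS.
  induction i as [ | i IH]; simpl.
  - now apply CPS_cv_hyp_coef.
  - now apply CPS_cv_derive.
Qed.

Lemma twice_derivable_hyp2F1 (q r g : C) :
  (forall m : nat, g + RtoC (INR m) <> 0)%C ->
  twice_derivable_with (hyp2F1_D 0 q r g) (hyp2F1_D 1 q r g) (hyp2F1_D 2 q r g).
Proof.
  intros Hg t Ht.
  assert (Rabs t < 1) by (rewrite Rabs_pos_eq; lra).
  split; now apply is_derive_hyp2F1_D.
Qed.

(** The power s^w is kept as a common factor, so it can later be divided out of the equation; the
    inner 1 - s reverses the sign of odd derivatives. *)
Lemma twice_derivable_Rpow_hyp2F1 (w q r g : C) :
  (forall m : nat, g + RtoC (INR m) <> 0)%C ->
  twice_derivable_with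
    (fun s => Rpow_C s w * hyp2F1_D 0 q r g (1 - s))%C
    (fun s => Rpow_C s w * (w * RtoC (/ s) * hyp2F1_D 0 q r g (1 - s)
                            - hyp2F1_D 1 q r g (1 - s)))%C
    (fun s => Rpow_C s w * (w * (w - 1) * RtoC (/ s) ^ 2 * hyp2F1_D 0 q r g (1 - s)
                            - 2 * w * RtoC (/ s) * hyp2F1_D 1 q r g (1 - s)
                            + hyp2F1_D 2 q r g (1 - s)))%C.
Proof.
  intros Hg s Hs.
  assert (Hz : Rabs (1 - s) < 1) by (rewrite Rabs_pos_eq; lra).
  assert (D : forall i, is_derive_RC (fun s => hyp2F1_D i q r g (1 - s)) s
    (RtoC (-1) * hyp2F1_D (S i) q r g (1 - s))).
  { intros i. apply (is_derive_RC_comp (hyp2F1_D i q r g) (fun s => 1 - s)).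
    - now apply is_derive_hyp2F1_D.
    - auto_derive; auto; ring. }
  assert (I : is_derive_RC (fun s => RtoC (/ s)) s (RtoC (- (/ s) ^ 2))).
  { apply is_derive_RC_RtoC. auto_derive; [lra | field; lra]. }
  assert (E := is_derive_Rpow_C w s (proj1 Hs)).
  unfold Cdiv in E. rewrite <- RtoC_inv in E by lra.
  split; (eapply is_derive_RC_eq; [ apply is_derive_RC_mult; [exact E | ] | ]).
  - apply (D O).
  - cbv beta. ring.
  - apply is_derive_RC_plus.
    + apply is_derive_RC_mult; [ | apply (D O)].
      apply is_derive_RC_mult; [apply is_derive_RC_const | exact I].
    + apply (is_derive_RC_ext_loc
        (fun s => RtoC (-1) * hyp2F1_D 1 q r g (1 - s))%C).
      { apply filter_forall. intros u. ring. }
      apply is_derive_RC_mult; [apply is_derive_RC_const | apply (D 1%nat)].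
  - cbv beta. push_RtoC. ring.
Qed.

(** * Joint eigenfunctions of [C12] and [C34] *)

Theorem theorem4p2 (a b c d : R) (p : C) (k : nat)
  (ha : forall n : nat, (a + 1)%R <> (- INR n)%R)
  (hc : forall n : nat, (c + 1)%R <> (- INR n)%R) :
  twice_partially_derivable (Psi_tilde a b c d p k) /\
  forall x y : R, in_triangle x y ->
    C12 a b c d (Psi_tilde a b c d p k) x y
      = ((4 * p ^ 2 - 1) / 4 * Psi_tilde a b c d p k x y)%C /\
    C34 a b (Psi_tilde a b c d p k) x y
      = (RtoC (((2 * INR k + a + b + 1) ^ 2 - 1) / 4)%R
         * Psi_tilde a b c d p k x y)%C.
Proof.
  (* Genericity, read as nonvanishing in C of every factor of the Pochhammer symbols in the
     denominators. *)
  assert (G : forall r, (forall n : nat, (r + 1)%R <> (- INR n)%R) ->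
    forall n : nat, (RtoC (r + 1) + RtoC (INR n))%C <> 0).
  { intros r Hr n H. rewrite <- RtoC_plus in H. apply RtoC_inj in H.
    apply (Hr n). lra. }
  assert (Ga := G a ha). assert (Gc := G c hc). clear G ha hc.
  (* The parameters keep the literal form in which [Psi_tilde] unfolds. Simplified, w = p -
     (2a+b+d+4)/2, qc = p + (d-b+1)/2 and rc = p + (b+2c-d+1)/2. *)
  set (qa := RtoC (- INR k)). set (ra := RtoC (INR k + a + b + 1)).
  set (w := (p - RtoC ((2 * a + b + d + 3 + 1) / 2))%C).
  set (qc := (p + RtoC ((c + (d - b - c) + 1) / 2))%C).
  set (rc := (p + RtoC ((c - (d - b - c) + 1) / 2))%C).
  assert (HP := twice_derivable_hyp2F1 qa ra _ Ga).
  assert (Hf := twice_derivable_Rpow_hyp2F1 w qc rc _ Gc).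
  set (g := Psi_tilde a b c d p k).
  assert (Hg : forall x y, in_triangle x y ->
    g x y = (hyp2F1_D 0 qa ra (RtoC (a + 1)) (x / (x + y))%R *
      (fun s => Rpow_C s w * hyp2F1_D 0 qc rc (RtoC (c + 1)) (1 - s)%R) (x + y)%R)%C).
  { intros x y _. unfold g, Psi_tilde, Phat, psi. now rewrite !hyp2F1_CPS. }
  split; [exact (sep_twice_partially_derivable _ _ _ _ _ _ _ HP Hf Hg) | ].
  intros x y T. split.
  - rewrite (C12_sep _ _ _ _ _ _ g a b c d x y HP Hf Hg T), (Hg x y T).
    set (s := (x + y)%R). cbv beta.
    assert (Hs : 0 < s < 1) by (unfold in_triangle in T; unfold s; lra).
    assert (Hz : Rabs (1 - s) < 1) by (rewrite Rabs_pos_eq; lra).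
    assert (E := hypergeometric_equation qc rc _ (1 - s) Gc Hz).
    change (CPS (hyp_coef qc rc (RtoC (c + 1))))
      with (hyp2F1_D 0 qc rc (RtoC (c + 1))) in E.
    change (CPS (CPS_derive (hyp_coef qc rc (RtoC (c + 1)))))
      with (hyp2F1_D 1 qc rc (RtoC (c + 1))) in E.
    change (CPS (CPS_derive (CPS_derive (hyp_coef qc rc (RtoC (c + 1))))))
      with (hyp2F1_D 2 qc rc (RtoC (c + 1))) in E.
    (* The values of the series and of the power become free complex numbers; [E] is the only
       relation kept among them. *)
    generalize dependent (hyp2F1_D 0 qc rc (RtoC (c + 1)) (1 - s)); intros F0 E.
    generalize dependent (hyp2F1_D 1 qc rc (RtoC (c + 1)) (1 - s)); intros F1 E.
    generalize dependent (hyp2F1_D 2 qc rc (RtoC (c + 1)) (1 - s)); intros F2 E.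
    generalize (hyp2F1_D 0 qa ra (RtoC (a + 1)) (x / s)); intros P.
    generalize (Rpow_C s w); intros W. clearbody s.
    assert (Hs' : RtoC s <> 0) by (apply RtoC_neq_0; lra).
    rewrite RtoC_inv by lra.
    (* Both sides differ by [P * W * s] times the Gauss equation. *)
    match type of E with ?X = _ =>
      match goal with |- _ = ?Y => transitivity (Y + P * W * RtoC s * X)%C end end;
      [ | rewrite E; ring].
    unfold w, qc, rc. clear - Hs'.
    rewrite ?RtoC_opp, !RtoC_div by lra. push_RtoC. field. exact Hs'.
  - assert (Ht := in_triangle_ratio _ _ T).
    assert (Hz : Rabs (x / (x + y)) < 1) by (rewrite Rabs_pos_eq; lra).
    assert (E := hypergeometric_equation qa ra _ _ Ga Hz).
    (* The Gauss equation with q = -k and r = k+a+b+1 gives lambda = -qr = k(k+a+b+1); adding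
       ((a+b+1)^2 - 1)/4 completes the square to ((2k+a+b+1)^2 - 1)/4. *)
    rewrite (C34_sep _ _ _ _ _ _ g a b x y (- (qa * ra)) HP Hf Hg T).
    + f_equal. unfold qa, ra. rewrite ?RtoC_opp, !RtoC_div by lra. push_RtoC. field.
    + rewrite <- E. unfold hyp2F1_D, qa, ra; simpl. push_RtoC. ring.
Qed.
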